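(* Let $G$ be a connected graph of order $n\ge 2$ and let $H$ be a non-trivial graph. If there exists an adjacency basis $S$ for $H$ which is also a dominating set of $H$, and such that for every $v\in V(H)\setminus S$ we have $S\not\subseteq N_H(v)$, then $$\operatorname{dim}_A(G\odot H)=n\cdot \operatorname{dim}_A(H).$$
   Context: All graphs are finite, simple, undirected; non-trivial means order at least 2. A set $S\subseteq V(H)$ is an adjacency generator for $H$ if for every two distinct $x,y\in V(H)\setminus S$ there exists $s\in S$ with $|N_H(s)\cap\{x,y\}|=1$ ($N_H$ the open neighbourhood); an adjacency basis is an adjacency generator of minimum cardinality, and this cardinality is $\operatorname{dim}_A(H)$. A dominating set $D$ satisfies $\bigcup_{v\in D}N_H[v]=V(H)$. The corona product $G\odot H$ ($G$ of order $n$ with vertices $v_1,\dots,v_n$) consists of $G$ and $n$ disjoint copies $H_1,\dots,H_n$ of $H$, with $v_i$ joined to every vertex of $H_i$. *)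

(* Defs.v *)
From mathcomp Require Import all_boot.

Set Implicit Arguments.
Unset Strict Implicit.
Unset Printing Implicit Defensive.

Record sgraph := SGraph {
  vertex :> finType;
  adj : rel vertex;
  adj_sym : symmetric adj;
  adj_irr : irreflexive adj
}.

Definition open_nbhd (G : sgraph) (v : G) : {set G} := [set u | adj v u].

Definition closed_nbhd (G : sgraph) (v : G) : {set G} := v |: open_nbhd v.

Definition connected_graph (G : sgraph) : Prop :=
  forall u v : G, connect (@adj G) u v.

Definition dominating (G : sgraph) (D : {set G}) : bool :=
  \bigcup_(v in D) closed_nbhd v == [set: G].

Definition adj_generator (G : sgraph) (S : {set G}) : bool :=
  [forall x, forall y, [&& x \notin S, y \notin S & x != y] ==>
    [exists s in S, #|open_nbhd s :&: [set x; y]| == 1]].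

Lemma adj_generatorT (G : sgraph) : adj_generator [set: G].
Proof. by apply/forallP => x; apply/forallP => y; rewrite in_setT. Qed.

Definition adj_basis (G : sgraph) (S : {set G}) : bool :=
  adj_generator S && [forall S' : {set G}, adj_generator S' ==> (#|S| <= #|S'|)].

(* The default [set: G] is always an adjacency generator (adj_generatorT), so
   this is the cardinality of an adjacency generator of minimum cardinality. *)
Definition adj_dim (G : sgraph) : nat :=
  #|[arg min_(S < [set: G] | adj_generator S) #|S|]|.

Lemma adj_basisP (G : sgraph) (S : {set G}) :
  adj_basis S = adj_generator S && (#|S| == adj_dim G).
Proof.
rewrite /adj_basis /adj_dim; case: arg_minnP => [|B genB minB].
  exact: adj_generatorT.
case genS: (adj_generator S) => //=; apply/forallP/eqP => [minS | -> S'].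
  by apply/eqP; rewrite eqn_leq minB // andbT (implyP (minS B)).
by apply/implyP; apply: minB.
Qed.

Section Corona.
Variables G H : sgraph.

(* inl v is the vertex v of G, inr (v, x) is the vertex x of the copy of H
   attached to v. *)
Definition corona_vertex : finType := (G + G * H)%type.

Definition corona_adj : rel corona_vertex := fun a b =>
  match a, b with
  | inl u, inl v => adj u v
  | inl u, inr (v, _) => u == v
  | inr (u, _), inl v => u == v
  | inr (u, x), inr (v, y) => (u == v) && adj x y
  end.

Lemma corona_adj_sym : symmetric corona_adj.
Proof.
case=> [u | [u x]] [v | [v y]] //=; rewrite ?(eq_sym u) //; first exact: adj_sym.
by rewrite adj_sym.
Qed.

Lemma corona_adj_irr : irreflexive corona_adj.
Proof. by case=> [u | [u x]] /=; rewrite adj_irr ?andbF. Qed.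

Definition corona : sgraph := SGraph corona_adj_sym corona_adj_irr.

End Corona.

(* Main.v *)
Require Import Defs.
From mathcomp Require Import all_boot.

(** The copies of an adjacency basis [S] of [H] form an adjacency generator of
    the corona product: domination separates vertices of different copies of
    [H], and the condition [S] not contained in [N(v)] separates a vertex of a
    copy from the vertex of [G] it is attached to. Conversely, two vertices of
    one copy of [H] have the same neighbours outside that copy, so every
    adjacency generator of the corona product restricts to an adjacency
    generator of each copy. *)

(** For distinct [x] and [y] the cardinality is the sum of the two adjacency bits, which is 1
    exactly when they differ. *)
Lemma adj_separatesE (G : sgraph) (s x y : G) : x != y ->
  (#|open_nbhd s :&: [set x; y]| == 1) = adj s x (+) adj s y.
Proof.
move=> neq_xy; rewrite setIC -sum1_card.
under eq_bigl do rewrite in_setI.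
by rewrite big_mkcondr big_setU1 ?inE //= big_set1 !inE; do 2 case: adj.
Qed.

Lemma adj_generatorP (G : sgraph) (S : {set G}) :
  reflect (forall x y, x \notin S -> y \notin S -> x != y ->
             exists2 s, s \in S & adj s x (+) adj s y)
          (adj_generator S).
Proof.
apply: (iffP 'forall_forallP) => [genS x y xS yS neq_xy | sepS x y].
  have /exists_inP[s sS] := implyP (genS x y) (introT and3P (And3 xS yS neq_xy)).
  by rewrite adj_separatesE //; exists s.
apply/implyP=> /and3P[xS yS neq_xy]; have [s sS sep_s] := sepS x y xS yS neq_xy.
by apply/exists_inP; exists s; rewrite ?adj_separatesE.
Qed.

Lemma adj_dim_leq (G : sgraph) (S : {set G}) : adj_generator S -> adj_dim G <= #|S|.
Proof.
rewrite /adj_dim; case: arg_minnP => [|B _ minB]; first exact: adj_generatorT.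
exact: minB.
Qed.

Lemma adj_basis_exists (G : sgraph) : exists S : {set G}, adj_basis S.
Proof.
rewrite /adj_basis.
case: (arg_minnP (fun S : {set G} => #|S|) (adj_generatorT G)) => S genS minS.
by exists S; rewrite genS; apply/forallP=> S'; apply/implyP=> /minS.
Qed.

Lemma dominatingP (G : sgraph) (D : {set G}) :
  reflect (forall x, x \notin D -> exists2 s, s \in D & adj s x) (dominating D).
Proof.
apply: (iffP eqP) => [domD x xD | domD].
  have /bigcupP[s sD] : x \in \bigcup_(v in D) closed_nbhd v by rewrite domD inE.
  by rewrite !inE => /predU1P[xs|]; [rewrite xs sD in xD | exists s].
apply/setP=> x; rewrite inE; apply/bigcupP; have [xD | xD] := boolP (x \in D).
  by exists x; rewrite // setU11.
by have [s sD sx] := domD x xD; exists s; rewrite // !inE sx orbT.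
Qed.

Definition corona_copies (G H : sgraph) (S : {set H}) : {set corona G H} :=
  [set inr p | p in setX [set: G] S].

Definition corona_fiber (G H : sgraph) (T : {set corona G H}) (v : G) : {set H} :=
  [set x | (inr (v, x) : corona G H) \in T].

Lemma mem_corona_copies (G H : sgraph) (S : {set H}) (v : G) (x : H) :
  ((inr (v, x) : corona G H) \in corona_copies G H S) = (x \in S).
Proof. by rewrite mem_imset ?inE // => p q []. Qed.

Lemma card_corona_copies (G H : sgraph) (S : {set H}) :
  #|corona_copies G H S| = #|G| * #|S|.
Proof. by rewrite card_imset ?cardsX ?cardsT // => p q []. Qed.

(** The fibers partition the part of [T] inside the copies of [H]; vertices of [G] in [T] are not
    counted, hence only an inequality. *)
Lemma sum_card_corona_fiber (G H : sgraph) (T : {set corona G H}) :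
  \sum_v #|corona_fiber G H T v| <= #|T|.
Proof.
pose A : {set G * H} := [set p | (inr p : corona G H) \in T].
have -> : \sum_v #|corona_fiber G H T v| = #|A|.
  under eq_bigr do rewrite -sum1_card.
  by rewrite pair_big_dep -sum1_card; apply: eq_bigl => -[v x]; rewrite !inE.
have inr_inj : injective (inr : G * H -> corona G H) by move=> p q [].
rewrite -(card_imset A inr_inj); apply/subset_leq_card/subsetP=> t /imsetP[p].
by rewrite inE => pT ->.
Qed.

(** A vertex of [G] is adjacent to all of the copy at [v] or to none of it, and a vertex of another
    copy to none of it. So whatever separates two vertices of this copy lies in the copy itself. *)
Lemma corona_fiber_generator (G H : sgraph) (T : {set corona G H}) (v : G) :
  adj_generator T -> adj_generator (corona_fiber G H T v).
Proof.
move=> /adj_generatorP genT; apply/adj_generatorP=> x y; rewrite !inE => xT yT neq_xy.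
have neq_vxy : (inr (v, x) : corona G H) != inr (v, y).
  by apply: contra_neq neq_xy => -[].
have [[u | [u s]] tT /=] := genT _ _ xT yT neq_vxy; first by rewrite addbb.
by have [uv | //] := eqVneq u v; rewrite uv in tT; exists s; rewrite // inE.
Qed.

Lemma corona_copies_generator (G H : sgraph) (S : {set H}) :
    S != set0 -> adj_generator S -> dominating S ->
    (forall v : H, v \notin S -> ~~ (S \subset open_nbhd v)) ->
  adj_generator (corona_copies G H S).
Proof.
move=> /set0Pn[s0 s0S] /adj_generatorP genS /dominatingP domS nsubS.
(* The witness lies in the copy at [u], so it is adjacent to the root [u]. Being a non-neighbour of
   [x] in [H], it misses [(v, x)] even when [u = v]. *)
have sep_root (u v : G) (x : H) : x \notin S ->
    exists2 t, t \in corona_copies G H S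
      & (adj t (inl u : corona G H)) (+) (adj t (inr (v, x) : corona G H)).
  move=> xS; have /subsetPn[s sS] := nsubS x xS; rewrite inE adj_sym => nsx.
  exists (inr (u, s)); first by rewrite mem_corona_copies.
  by rewrite /= eqxx (negPf nsx) andbF.
apply/adj_generatorP=> -[u | [u x]] [v | [v y]]; rewrite ?mem_corona_copies.
(* The only neighbour of [(u, s0)] in [G] is [u]. *)
- move=> _ _ neq_uv; exists (inr (u, s0)); first by rewrite mem_corona_copies.
  rewrite /= eqxx; have [uv | //] := eqVneq u v.
  by rewrite uv eqxx in neq_uv.
- by move=> _ yS _; apply: sep_root.
- move=> xS _ _; have [t tT sep_t] := sep_root v u x xS.
  by exists t; rewrite // addbC.
- move=> xS yS neq; have [uv | neq_uv] := eqVneq u v.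
    rewrite uv in neq *.
    have neq_xy : x != y by apply: contra_neq neq => ->.
    have [s sS sep_s] := genS x y xS yS neq_xy.
    by exists (inr (v, s)); rewrite ?mem_corona_copies //= eqxx.
  (* A dominator of [x] taken in the copy at [u] has no neighbour in the copy at [v]. *)
  have [s sS sx] := domS x xS; exists (inr (u, s)); first by rewrite mem_corona_copies.
  by rewrite /= eqxx sx (negPf neq_uv).
Qed.

Theorem theorem6 (G H : sgraph) (connG : connected_graph G)
    (orderG : 2 <= #|G|) (orderH : 2 <= #|H|)
    (hS : exists S : {set H},
        [/\ adj_basis S, dominating S
          & forall v : H, v \notin S -> ~~ (S \subset open_nbhd v)]) :
  adj_dim (corona G H) = #|G| * adj_dim H.
Proof.
have [S [+ domS nsubS]] := hS; rewrite adj_basisP => /andP[genS /eqP cardS].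
have S_neq0 : S != set0.
  have /card_gt0P[x _] : 0 < #|H| by exact: ltnW.
  apply/set0Pn; have [xS | xS] := boolP (x \in S); first by exists x.
  by have [s sS _] := dominatingP _ _ domS x xS; exists s.
(* Only the upper bound is restated through [S]; the lower bound keeps [adj_dim H], to be compared
   with each fiber of a basis [T]. *)
apply/eqP; rewrite eqn_leq -{1}cardS -card_corona_copies.
rewrite adj_dim_leq ?corona_copies_generator //=.
have [T] := adj_basis_exists (corona G H); rewrite adj_basisP => /andP[genT /eqP <-].
apply: leq_trans (sum_card_corona_fiber G H T); rewrite -sum_nat_const.
by apply: leq_sum => v _; apply/adj_dim_leq/corona_fiber_generator.
Qed.
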